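(* Let $F$ be a field, let $n\geq 2$ be an integer, and let $M_{n}(F)$ be the ring of $n\times n$ matrices over $F$. Then $\overrightarrow{\Gamma}_{E}(M_{n}(F))=\overrightarrow{\Gamma}(M_{n}(F))$ if and only if $n=2$.
   Context: For a ring $R$ and $A\subseteq R$, $A^{*}=A\setminus\{0\}$. An element $x\in R$ is a left (resp. right) zero divisor if $xy=0$ (resp. $yx=0$) for some $y\in R^{*}$; $Z(R)$ is the set of all elements that are left or right zero divisors. All digraphs are simple (no loops, no multiple arcs). The zero-divisor digraph $\overrightarrow{\Gamma}(R)$ has vertex set $Z(R)^{*}$, and for distinct $x,y\in Z(R)^{*}$, $x\to y$ is an arc if and only if $xy=0$. The extended zero-divisor digraph $\overrightarrow{\Gamma}_{E}(R)$ has the same vertex set, and for distinct $x,y\in Z(R)^{*}$, $x\to y$ is an arc if and only if $x^{k}y^{m}=0$ for some positive integers $k,m$ with $x^{k}\neq 0$ and $y^{m}\neq 0$. Equality of these digraphs means equality of arc sets. *)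

(* Defs.v *)
(* Mathematical Components, with the sets of mathcomp-classical. *)
From HB Require Import structures.
From mathcomp Require Import all_boot all_order all_algebra.
From mathcomp Require Import boolp classical_sets.

Set Implicit Arguments.
Unset Strict Implicit.
Unset Printing Implicit Defensive.

Import GRing.Theory.
Local Open Scope classical_set_scope.
Local Open Scope ring_scope.

Record digraph (T : Type) := Digraph {
  vertices : set T;
  arcs : set (T * T);
  arcs_vertices : forall x y, arcs (x, y) -> vertices x /\ vertices y;
  arcs_irrefl : forall x, ~ arcs (x, x)
}.

(* Everything below is stated over pzRingType, because 'M[F]_n has a canonical
   ring structure for a variable n only there (the zero ring is n = 0). *)

Definition left_zero_divisor (R : pzRingType) (x : R) : Prop :=
  exists2 y : R, y != 0 & x * y = 0.

Definition right_zero_divisor (R : pzRingType) (x : R) : Prop :=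
  exists2 y : R, y != 0 & y * x = 0.

Definition zero_divisors (R : pzRingType) : set R :=
  [set x | left_zero_divisor x \/ right_zero_divisor x].
Arguments zero_divisors R _ : clear implicits.

Definition nonzero_zero_divisors (R : pzRingType) : set R :=
  zero_divisors R `\ 0.
Arguments nonzero_zero_divisors R _ : clear implicits.

Definition zd_arcs (R : pzRingType) : set (R * R) :=
  [set p | [/\ nonzero_zero_divisors R p.1, nonzero_zero_divisors R p.2,
               p.1 <> p.2 & p.1 * p.2 = 0]].
Arguments zd_arcs R _ : clear implicits.

Definition ext_zd_arcs (R : pzRingType) : set (R * R) :=
  [set p | [/\ nonzero_zero_divisors R p.1, nonzero_zero_divisors R p.2,
               p.1 <> p.2 &
               exists k m : nat,
                 [/\ (0 < k)%N, (0 < m)%N, p.1 ^+ k * p.2 ^+ m = 0,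
                     p.1 ^+ k != 0 & p.2 ^+ m != 0]]].
Arguments ext_zd_arcs R _ : clear implicits.

Fact zd_arcs_vertices (R : pzRingType) (x y : R) :
  zd_arcs R (x, y) -> nonzero_zero_divisors R x /\ nonzero_zero_divisors R y.
Proof. by case. Qed.

Fact zd_arcs_irrefl (R : pzRingType) (x : R) : ~ zd_arcs R (x, x).
Proof. by case. Qed.

Fact ext_zd_arcs_vertices (R : pzRingType) (x y : R) :
  ext_zd_arcs R (x, y) ->
  nonzero_zero_divisors R x /\ nonzero_zero_divisors R y.
Proof. by case. Qed.

Fact ext_zd_arcs_irrefl (R : pzRingType) (x : R) : ~ ext_zd_arcs R (x, x).
Proof. by case. Qed.

Definition zero_divisor_digraph (R : pzRingType) : digraph R :=
  Digraph (@zd_arcs_vertices R) (@zd_arcs_irrefl R).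

Definition extended_zero_divisor_digraph (R : pzRingType) : digraph R :=
  Digraph (@ext_zd_arcs_vertices R) (@ext_zd_arcs_irrefl R).

(* Main.v *)
Require Import Defs.
From mathcomp Require Import all_boot all_order all_algebra.
From mathcomp Require Import boolp classical_sets.
From mathcomp Require Import ring.

(** A singular 2 x 2 matrix [x] satisfies [x ^ 2 = \tr x *: x], by
    Cayley-Hamilton with zero determinant, so every positive power of [x] is a
    scalar multiple of [x] ([expr_singular_mx22]).  If [x ^ k] and [y ^ m] are
    nonzero, these scalars are nonzero, and [x ^ k * y ^ m = 0] forces
    [x * y = 0]: for n = 2 the extended digraph has no new arcs.

    For n >= 3 there is room for a nilpotent matrix whose square is nonzero.
    For [x = E_01 + E_12] and [y = E_11] one has [x ^ 2 = E_02], hence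
    [x ^ 2 * y = 0] although [x * y = E_01] is nonzero
    ([extended_arc_not_arc]). *)

Import GRing.Theory.
Local Open Scope ring_scope.

Lemma zd_arcs_sub_ext (R : pzRingType) (p : R * R) :
  zd_arcs R p -> ext_zd_arcs R p.
Proof.
move=> [Zx Zy nxy xy0]; split=> //; exists 1%N, 1%N.
case: Zx Zy => _ /eqP x0 [_ /eqP y0].
by rewrite !expr1.
Qed.

Lemma zero_divisor_det0 (F : fieldType) (n : nat) (x : 'M[F]_n) :
  zero_divisors 'M[F]_n x -> \det x = 0.
Proof.
move=> zx; apply/eqP; apply: contraT.
rewrite -unitfE -unitmxE => ux.
case: zx => -[y /eqP y0 e]; case: y0; move: e; rewrite -mulmxE => e.
- by rewrite -(mulKmx ux y) e mulmx0.
- by rewrite -(mulmxK ux y) e mul0mx.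
Qed.

Lemma det_mx22 (R : comPzRingType) (x : 'M[R]_2) :
  \det x = x 0 0 * x 1 1 - x 0 1 * x 1 0.
Proof.
rewrite (expand_det_row _ 0) !big_ord_recl big_ord0 /cofactor !det_mx11 !mxE.
rewrite !expr0 !expr1 !mul1r addr0 mulN1r mulrN.
by congr (x _ _ * x _ _ - x _ _ * x _ _); apply: val_inj.
Qed.

(** Cayley-Hamilton in dimension 2, where the constant term of the
    characteristic polynomial is the determinant. *)
Lemma sqr_singular_mx22 (F : fieldType) (x : 'M[F]_2) :
  \det x = 0 -> x *m x = \tr x *: x.
Proof.
move=> d0.
have {}d0 : x 0 0 * x 1 1 = x 0 1 * x 1 0.
  apply/eqP; rewrite -subr_eq0 -d0 det_mx22; apply/eqP; ring.
have ord2 (i : 'I_2) : i = 0 \/ i = 1.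
  by case: i => [[|[|//]] ?]; [left | right]; apply: val_inj.
apply/matrixP => i j; rewrite !mxE /mxtrace !big_ord_recl !big_ord0.
rewrite (_ : lift ord0 ord0 = 1); last exact: val_inj.
rewrite (_ : ord0 = 0) //.
by case: (ord2 i) => ->; case: (ord2 j) => ->; ring: d0.
Qed.

Lemma expr_singular_mx22 (F : fieldType) (x : 'M[F]_2) (k : nat) :
  \det x = 0 -> x ^+ k.+1 = \tr x ^+ k *: x.
Proof.
move=> d0; elim: k => [|k IH]; first by rewrite expr1 expr0 scale1r.
by rewrite exprSr IH -mulmxE -scalemxAl sqr_singular_mx22 // scalerA -exprSr.
Qed.

Lemma ext_zd_arcs_mx22_sub (F : fieldType) (p : 'M[F]_2 * 'M[F]_2) :
  ext_zd_arcs 'M[F]_2 p -> zd_arcs 'M[F]_2 p.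
Proof.
case=> Zx Zy nxy [[|k] [[|m] []]] // _ _ xy0 xk ym; split=> //.
move: xy0 xk ym.
have dx := zero_divisor_det0 _ _ _ (proj1 Zx).
have dy := zero_divisor_det0 _ _ _ (proj1 Zy).
rewrite !expr_singular_mx22 // !scaler_eq0 !negb_or -!mulmxE.
rewrite -scalemxAl -scalemxAr scalerA => /eqP.
by rewrite scaler_eq0 mulf_eq0 => /orP[/orP[]|/eqP //] /eqP ->;
  rewrite eqxx.
Qed.

Lemma delta_mx_neq0 (F : fieldType) (n : nat) (i j : 'I_n) :
  delta_mx i j != 0 :> 'M[F]_n.
Proof.
by apply/eqP => /matrixP/(_ i j)/eqP; rewrite !mxE !eqxx oner_eq0.
Qed.

(** On the span of the indices [a], [b], [c], [x] is a nilpotent Jordan block: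
    multiplication by [y] on the right keeps column [b], which is the column
    of [x] that squaring kills. *)
Lemma extended_arc_not_arc (F : fieldType) (n : nat) (a b c : 'I_n) :
  a != b -> b != c -> a != c ->
  let x : 'M[F]_n := delta_mx a b + delta_mx b c in
  let y : 'M[F]_n := delta_mx b b in
  ext_zd_arcs 'M[F]_n (x, y) /\ ~ zd_arcs 'M[F]_n (x, y).
Proof.
move=> ab bc ac x y.
have xy : x *m y = delta_mx a b.
  by rewrite mulmxDl mul_delta_mx mul_delta_mx_0 ?addr0 // eq_sym.
have xx : x *m x = delta_mx a c.
  rewrite mulmxDl !mulmxDr mul_delta_mx.
  by rewrite !mul_delta_mx_0 ?addr0 ?add0r // eq_sym.
have xxy : x *m x *m y = 0 by rewrite xx mul_delta_mx_0 // eq_sym.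
(* Column [a] of both [x] and [y] vanishes, so [E_aa] shows that they are
   zero divisors. *)
have xa : x *m delta_mx a a = 0.
  by rewrite mulmxDl !mul_delta_mx_0 ?addr0 // eq_sym.
have ya : y *m delta_mx a a = 0 by rewrite mul_delta_mx_0 // eq_sym.
have y0 : y != 0 by apply: delta_mx_neq0.
have x0 : x != 0.
  by apply: contraNneq (delta_mx_neq0 F n a b) => x0; rewrite -xy x0 mul0mx.
split; last first.
  case=> _ _ _; rewrite /= -mulmxE xy => ab0.
  by have := delta_mx_neq0 F n a b; rewrite ab0 eqxx.
split=> /=.
- split; last exact/eqP.
  by left; exists (delta_mx a a); first exact: delta_mx_neq0.
- split; last exact/eqP.
  by left; exists (delta_mx a a); first exact: delta_mx_neq0.
- move=> exy; move: xxy.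
  have yy : y *m y = y by rewrite mul_delta_mx.
  by rewrite exy !yy => /eqP; rewrite (negPf y0).
- exists 2%N, 1%N; rewrite expr2 expr1 -!mulmxE xxy xx; split=> //.
  exact: delta_mx_neq0.
Qed.

Theorem theorem6p6 (F : fieldType) (n : nat) (hn : (2 <= n)%N) :
  arcs (extended_zero_divisor_digraph 'M[F]_n) =
    arcs (zero_divisor_digraph 'M[F]_n)
  <-> n = 2%N.
Proof.
split=> [eqA | n2].
- case: n hn eqA => [|[|[|n]]] // _ /= eqA.
  have [] := @extended_arc_not_arc F n.+3
    (inord 0) (inord 1) (inord 2); try by rewrite -val_eqE /= !inordK.
  by rewrite eqA.
- subst n; apply/seteqP; split=> p.
  + exact: ext_zd_arcs_mx22_sub.
  + exact: zd_arcs_sub_ext.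
Qed.
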